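(* Let $\Sigma$ be a Label Cover instance and $\Phi_\Sigma$ the weighted system constructed from $\Sigma$ as described in the context. Suppose that $\Phi_\Sigma$ is $(1/|\mathscr{H}_2|+\delta)$-satisfiable in $\mathscr{G}_2$. Then $\Sigma$ is $\alpha$-satisfiable, where $\alpha=\delta^2/(4\kappa|\mathscr{G}_1|^{\kappa}|\mathscr{G}_2|^4)$ and $\kappa=\lceil(\log_2\delta-2)/\log_2(1-\epsilon)\rceil$.
   Context: Fix finite groups $\mathscr{G}_1,\mathscr{G}_2$ and a group homomorphism $\varphi:\mathscr{H}_1\to\mathscr{H}_2$ where $\mathscr{H}_1\leq\mathscr{G}_1$, $\mathscr{H}_2=\mathrm{Im}(\varphi)\leq\mathscr{G}_2$, and $\varphi$ extends to a homomorphism $\mathscr{G}_1\to\mathscr{G}_2$; fix $\epsilon,\delta>0$ with $1/|\mathscr{H}_2|+\delta\leq 1-\epsilon$. A Label Cover instance $\Sigma$ with disjoint finite label sets $D,E$ is a bipartite graph on $U\sqcup V$ with a map $\pi_{uv}:D\to E$ for each edge $\{u,v\}$ ($u\in U,v\in V$); assignments $h_D:U\to D,h_E:V\to E$ satisfy edge $\{u,v\}$ if $\pi_{uv}(h_D(u))=h_E(v)$, and $\Sigma$ is $\alpha$-satisfiable if some pair of assignments satisfies at least an $\alpha$-fraction of the edges. For finite $N$, $\mathscr{G}_1^N$ is the direct power with componentwise operations, and $h\mathbf{g}$ for $h\in\mathscr{H}_1$ means $(h\mathbf{g}(n))_n$. Fix a representative in each right coset $\mathscr{H}_1\mathbf{x}$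 of $\mathscr{H}_1$ in $\mathscr{G}_1^E$ (and in $\mathscr{G}_1^D$), denoted $\mathbf{x}^\dagger$; for $\mathbf{a}\in\mathscr{G}_1^E$ let $g_{\mathbf{a}}\in\mathscr{H}_1$ with $\mathbf{a}^\dagger=g_{\mathbf{a}}\mathbf{a}$. The system $\Phi_\Sigma$ has variable set $X=\{u_{\mathbf{b}}: u\in U,\mathbf{b}\in\mathscr{G}_1^D\}\sqcup\{v_{\mathbf{a}}:v\in V,\mathbf{a}\in\mathscr{G}_1^E\}$ and contains, for each edge $\{u,v\}$, $\mathbf{a}\in\mathscr{G}_1^E$, $\mathbf{b},\boldsymbol{\nu}\in\mathscr{G}_1^D$, $s_1,s_2\in\{-1,1\}$, the equation $v_{\mathbf{a}^\dagger}\,u_{\mathbf{b}^{s_1}}^{s_1}\,u_{\mathbf{c}^{s_2}}^{s_2}=g_{\mathbf{a}}$, where $\mathbf{c}=\mathbf{b}^{-1}(\mathbf{a}\circ\pi_{uv})^{-1}\boldsymbol{\nu}$, with weight equal to the probability of the following independent choices: the edge is uniform among edges of $\Sigma$; $\mathbf{a},\mathbf{b}$ uniform in $\mathscr{G}_1^E,\mathscr{G}_1^D$; independently for each $d\in D$, $\boldsymbol{\nu}(d)=1$ with probability $1-\epsilon$ and uniform in $\mathscr{G}_1$ with probability $\epsilon$; $s_1,s_2$ uniform in $\{-1,1\}$. An assignment $f:X\to\mathscr{G}_2$ satisfies an equation with right-hand side $g$ if the product of the assigned values (with exponents) equals $\varphi(g)$; $\Phi_\Sigma$ is $t$-satisfiable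 in $\mathscr{G}_2$ if some $f$ satisfies equations of total weight at least $t$. *)

(* Defs.v *)
From HB Require Import structures.
From mathcomp Require Import all_boot all_order all_algebra all_fingroup.
From mathcomp Require Import reals exp.

Set Implicit Arguments.
Unset Strict Implicit.
Unset Printing Implicit Defensive.

Import Order.TTheory GRing.Theory Num.Theory.
Local Open Scope ring_scope.

(* The values of [lc_map] on pairs that are not edges are never used. *)
Record label_cover (U V D E : finType) := LabelCover {
  lc_edges : {set U * V};
  lc_map : U -> V -> D -> E
}.

Definition lc_satisfied (U V D E : finType) (S : label_cover U V D E)
    (hD : U -> D) (hE : V -> E) : {set U * V} :=
  [set e in lc_edges S | lc_map S e.1 e.2 (hD e.1) == hE e.2].

Definition lc_satisfiable (R : realType) (U V D E : finType)
    (S : label_cover U V D E) (alpha : R) : Prop :=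
  exists (hD : U -> D) (hE : V -> E),
    alpha * #|lc_edges S|%:R <= #|lc_satisfied S hD hE|%:R.

(* An exponent s in {1, -1} is encoded by a boolean: [false] is 1, [true] is
   -1, as in (-1) ^+ s. *)
Definition signg (gT : groupType) (s : bool) (x : gT) : gT :=
  if s then (x^-1)%g else x.

(* The left-hand side is a word in the signed variables (x, s), standing for
   x^s; the right-hand side is a constant. *)
Definition equation (X : Type) (gT : finGroupType) : Type :=
  (seq (X * bool) * gT)%type.

Definition weighted_system (R : realType) (X : Type) (gT : finGroupType)
  : Type := seq (R * equation X gT).

Definition eqn_satisfied (X : Type) (gT1 gT2 : finGroupType)
    (phi : gT1 -> gT2) (f : X -> gT2) (q : equation X gT1) : bool :=
  (\prod_(y <- q.1) signg y.2 (f y.1))%g == phi q.2.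

Definition system_satisfiable (R : realType) (X : Type)
    (gT1 gT2 : finGroupType) (phi : gT1 -> gT2)
    (Phi : weighted_system R X gT1) (t : R) : Prop :=
  exists f : X -> gT2, t <= \sum_(p <- Phi | eqn_satisfied phi f p.2) p.1.

(* The direct power gT^N is [{ffun N -> gT}] with the componentwise group
   structure of the library; a scalar h acts on it on the left as
   multiplication by the constant family [diag N h]. *)
Definition diag (N : finType) (gT : finGroupType) (h : gT)
  : {ffun N -> gT} := [ffun=> h].

Definition diag_rcoset (N : finType) (gT : finGroupType) (H : {set gT})
    (x : {ffun N -> gT}) : {set {ffun N -> gT}} :=
  [set (diag N h * x)%g | h in H].

Definition coset_representatives (N : finType) (gT : finGroupType)
    (H : {set gT}) (dag : {ffun N -> gT} -> {ffun N -> gT}) : Prop :=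
  (forall x, dag x \in diag_rcoset H x) /\
  (forall x y, diag_rcoset H x = diag_rcoset H y -> dag x = dag y).

Definition coset_multipliers (N : finType) (gT : finGroupType)
    (H : {set gT}) (dag : {ffun N -> gT} -> {ffun N -> gT})
    (g : {ffun N -> gT} -> gT) : Prop :=
  forall a, g a \in H /\ dag a = (diag N (g a) * a)%g.

Section System.
Variables (R : realType) (gT : finGroupType) (U V D E : finType).
Variable S : label_cover U V D E.

(* [inl (u, b)] is u_b and [inr (v, a)] is v_a. *)
Definition sys_var : Type :=
  ((U * {ffun D -> gT}) + (V * {ffun E -> gT}))%type.

Definition sys_eqn (dag : {ffun E -> gT} -> {ffun E -> gT})
    (g : {ffun E -> gT} -> gT) (e : U * V) (a : {ffun E -> gT})
    (b nu : {ffun D -> gT}) (s1 s2 : bool) : equation sys_var gT :=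
  let: (u, v) := e in
  let a_pi : {ffun D -> gT} := [ffun d => a (lc_map S u v d)] in
  let c : {ffun D -> gT} := (b^-1 * a_pi^-1 * nu)%g in
  ([:: (inr (v, dag a), false);
       (inl (u, signg s1 b), s1);
       (inl (u, signg s2 c), s2)],
   g a).

Definition noise_mass (eps : R) (x : gT) : R :=
  (1 - eps) * (x == 1%g)%:R + eps * #|gT|%:R^-1.

(* Edge, a, b, nu, s1 and s2 are chosen independently, all of them uniformly
   except nu; only nu enters the value. *)
Definition sys_weight (eps : R) (nu : {ffun D -> gT}) : R :=
  #|lc_edges S|%:R^-1 * #|{ffun E -> gT}|%:R^-1 * #|{ffun D -> gT}|%:R^-1
  * (\prod_(d : D) noise_mass eps (nu d)) * 2^-1 * 2^-1.

Definition sys_of (eps : R) (dag : {ffun E -> gT} -> {ffun E -> gT})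
    (g : {ffun E -> gT} -> gT) : weighted_system R sys_var gT :=
  [seq (let: (e, (a, b, nu, s1, s2)) := i in
        (sys_weight eps nu, sys_eqn dag g e a b nu s1 s2))
     | i : (U * V) * ({ffun E -> gT} * {ffun D -> gT} * {ffun D -> gT}
                      * bool * bool) in [pred i | i.1 \in lc_edges S]].

End System.

Definition log2 (R : realType) (x : R) : R := ln x / ln 2.

Definition kappa (R : realType) (eps delta : R) : int :=
  Num.ceil ((log2 delta - 2) / log2 (1 - eps)).

(* Main.v *)
Require Import Defs.
From HB Require Import structures.
From mathcomp Require Import all_boot all_order all_algebra all_fingroup.
From mathcomp Require Import reals exp.
From mathcomp Require Import ring lra.

Set Implicit Arguments.
Unset Strict Implicit.
Unset Printing Implicit Defensive.

Import Order.TTheory GRing.Theory Num.Theory.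
Local Open Scope ring_scope.

(* Folding makes the table A of a vertex v equivariant under H1, acting on the
   values through H2.  An indicator 1[A(a) B(b) C(c) = 1] is at most 1/|H2|
   plus the product, in the group algebra of G2, of the indicators of the three
   values, where the indicator of A(a) = x is diminished by its average over
   the coset H2 x and thereby has mean zero over a.

   In place of representations of G1 the proof uses the Efron-Stein
   decomposition of functions on G1^D: its components are convolutions with
   central idempotents of the group algebra of G1^D, so they commute with the
   convolution coming from b and c, and the noise nu multiplies the component
   of S by (1 - eps)^|S|.  Components with |S| >= kappa contribute at most
   delta/2 in total; a component with |S| < kappa only meets the components
   of A supported on nonempty subsets of pi(S).  Labelling u by a random
   element of a random S, and v by a random element of a random T, with S and
   T chosen with probability the squared norm of the component, therefore
   satisfies a delta^2 / (4 kappa |G2|) fraction of the edges on average. *)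

(** * Uniform averages over a finite type *)

Definition avg (R : realType) (T : finType) (f : T -> R) : R :=
  #|T|%:R^-1 * \sum_x f x.

Section Average.
Variables (R : realType) (T : finType).
Implicit Types f g : T -> R.

Lemma eq_avg f g : f =1 g -> avg f = avg g.
Proof. by move=> fg; congr (_ * _); apply: eq_bigr. Qed.

Lemma avg_eq0 f : (forall x, f x = 0) -> avg f = 0.
Proof. by move=> f0; rewrite /avg big1 ?mulr0. Qed.

Lemma avgD f g : avg (fun x => f x + g x) = avg f + avg g.
Proof. by rewrite /avg big_split mulrDr. Qed.

Lemma avgZ c f : avg (fun x => c * f x) = c * avg f.
Proof. by rewrite /avg -mulr_sumr mulrCA. Qed.

Lemma avg_sum (I : finType) (P : pred I) (F : I -> T -> R) :
  avg (fun x => \sum_(i | P i) F i x) = \sum_(i | P i) avg (F i).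
Proof. by rewrite /avg exchange_big /= mulr_sumr. Qed.

Lemma ler_avg f g : (forall x, f x <= g x) -> avg f <= avg g.
Proof.
by move=> fg; rewrite ler_wpM2l ?invr_ge0 ?ler0n //; apply: ler_sum.
Qed.

Lemma avg_ge0 f : (forall x, 0 <= f x) -> 0 <= avg f.
Proof. by move=> f0; rewrite mulr_ge0 ?invr_ge0 ?ler0n // sumr_ge0. Qed.

Lemma avg_cst (x0 : T) (c : R) : avg (fun _ : T => c) = c.
Proof.
rewrite /avg sumr_const -[c *+ _]mulr_natl mulrA mulVf ?mul1r //.
by rewrite pnatr_eq0 -lt0n; apply/card_gt0P; exists x0.
Qed.

Lemma reindex_avg (h : T -> T) f : injective h -> avg f = avg (f \o h).
Proof. by move=> hI; rewrite /avg (reindex_inj hI). Qed.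

End Average.

(** * Efron-Stein decomposition on a direct power of a finite group *)

Section EfronStein.
Variables (R : realType) (gT : finGroupType) (N : finType).
Local Notation G := {ffun N -> gT}.
Implicit Types (S T : {set N}) (f g : G -> R) (x y z : G).

(** Two complementary central idempotents of the group algebra of [gT]: for [s] false the uniform
    distribution, which projects onto constants, and for [s] true its complement, which projects
    onto functions of mean zero. *)
Definition es_factor (s : bool) (t : gT) : R :=
  (if s then (t == 1%g)%:R else 0) + (-1) ^+ s * #|gT|%:R^-1.

Definition es_kernel S y : R := \prod_d es_factor (d \in S) (y d).

(* The component of the Efron-Stein decomposition of [f] supported on the
   coordinates in [S], as a convolution. *)
Definition es S f x : R := \sum_y es_kernel S y * f (x * y)%g.

Lemma natr_card_group_neq0 : #|gT|%:R != 0 :> R.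
Proof. by rewrite pnatr_eq0 -lt0n -cardsT cardG_gt0. Qed.

Lemma sum_eq1 (h : gT -> R) (t : gT) : \sum_s (s == t)%:R * h s = h t.
Proof.
rewrite (bigD1 t) //= eqxx mul1r big1 ?addr0 // => s /negPf ->.
by rewrite mul0r.
Qed.

Lemma es_factor_sum s : \sum_t es_factor s t = (~~ s)%:R.
Proof.
rewrite /es_factor big_split /= sumr_const -[_ *+ _]mulr_natr -mulrA.
rewrite mulVf ?natr_card_group_neq0 // mulr1.
case: s; last by rewrite big1 // add0r expr0.
rewrite -[X in X + _]/(\sum_t (t == 1%g)%:R).
under eq_bigr do rewrite -[_%:R]mulr1.
by rewrite (sum_eq1 (fun=> 1)) expr1 subrr.
Qed.

Lemma es_factor_conv s t u :
  \sum_v es_factor s v * es_factor t (v^-1 * u)%g =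
  (s == t)%:R * es_factor s u.
Proof.
have sumV : \sum_v es_factor t (v^-1 * u)%g = (~~ t)%:R.
  rewrite -es_factor_sum.
  have hI : injective (fun v : gT => v^-1 * u)%g.
    by move=> v w /mulIg /invg_inj.
  by rewrite [in RHS](reindex_inj hI).
under eq_bigr do rewrite /es_factor -/(es_factor t _) mulrDl.
rewrite big_split /= -mulr_sumr sumV.
case: s => /=.
  rewrite (sum_eq1 (fun v => es_factor t (v^-1 * u)%g)) invg1 mul1g /es_factor.
  by case: t sumV => _ /=; rewrite ?eqxx; ring.
under eq_bigr do rewrite mul0r.
by rewrite big1 // /es_factor; case: t sumV => _ /=; ring.
Qed.

(** The convolution factors over the coordinates, and a coordinate lying in only one of [S] and [T]
    contributes the factor zero. *)
Lemma es_kernel_conv S T z :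
  \sum_y es_kernel S y * es_kernel T (y^-1 * z)%g =
  (S == T)%:R * es_kernel S z.
Proof.
under eq_bigr do rewrite /es_kernel -big_split /=.
transitivity (\prod_d \sum_v es_factor (d \in S) v
   * es_factor (d \in T) (v^-1 * z d)%g).
  rewrite bigA_distr_bigA; apply: eq_bigr => y _.
  by apply: eq_bigr => d _; rewrite !ffunE.
under eq_bigr do rewrite es_factor_conv.
have [<-|neq] := eqVneq S T.
  by rewrite mul1r; apply: eq_bigr => d _; rewrite eqxx mul1r.
have [d Hd] : exists d, (d \in S) != (d \in T).
  apply/existsP; apply: contraNT neq; rewrite negb_exists => /forallP H.
  by apply/eqP/setP => d; apply/eqP; move: (H d); rewrite negbK.
by rewrite (bigD1 d) //= (negPf Hd) !mul0r.
Qed.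

Lemma es_es S T f x : es S (es T f) x = (S == T)%:R * es S f x.
Proof.
rewrite /es mulr_sumr.
transitivity
  (\sum_w (\sum_y es_kernel S y * es_kernel T (y^-1 * w)%g) * f (x * w)%g).
  under [RHS]eq_bigr do rewrite mulr_suml.
  rewrite exchange_big /=; apply: eq_bigr => y _.
  rewrite mulr_sumr [RHS](reindex_inj (mulgI y)) /=; apply: eq_bigr => z _.
  by rewrite mulKg !mulgA mulrA.
by apply: eq_bigr => w _; rewrite es_kernel_conv mulrA.
Qed.

Lemma es_kernelV S y : es_kernel S y^-1%g = es_kernel S y.
Proof.
by apply: eq_bigr => d _; rewrite !ffunE /es_factor; case: ifP; rewrite ?eq_invg1.
Qed.

(** Centrality of the kernel: each factor only tests whether its argument is the identity. *)
Lemma es_kernelJ S x y : es_kernel S (x^-1 * y * x)%g = es_kernel S y.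
Proof.
apply: eq_bigr => d _; rewrite !ffunE /es_factor; case: ifP => // _.
by rewrite -mulgA -conjgE conjg_eq1.
Qed.

(** In each coordinate the noise is [(1 - eps)] times [es_factor true] plus [es_factor false];
    expanding the product over [d] yields one kernel for each set [S]. *)
Lemma noise_decomposition (eps : R) f x :
  \sum_(y : G) (\prod_d noise_mass eps (y d)) * f (x * y)%g =
  \sum_(S : {set N}) (1 - eps) ^+ #|S| * es S f x.
Proof.
under [RHS]eq_bigr do rewrite /es mulr_sumr.
rewrite exchange_big /=; apply: eq_bigr => y _.
under [RHS]eq_bigr do rewrite mulrA.
rewrite -mulr_suml; congr (_ * _).
transitivity (\prod_d ((1 - eps) * es_factor true (y d) + es_factor false (y d))).
  by apply: eq_bigr => d _; rewrite /noise_mass /es_factor /=; ring.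
rewrite bigA_distr; apply: eq_bigr => S _.
rewrite -prodr_const [X in _ = X * _]big_mkcond -big_split /=.
by apply: eq_bigr => d _; case: ifP => _ //; rewrite mul1r.
Qed.

Lemma sum_es f x : \sum_(S : {set N}) es S f x = f x.
Proof.
(* At noise rate zero the noise is the point mass at the identity, and every coefficient
   [(1 - 0) ^+ #|S|] is 1. *)
have := noise_decomposition 0 f x; under eq_bigr => y _.
  have -> : \prod_d noise_mass (0 : R) (y d) = (y == 1%g)%:R.
    rewrite /noise_mass; have [->|yN] := eqVneq y 1%g.
      by apply: big1 => d _; rewrite !ffunE eqxx mul0r subr0 mulr1 addr0.
    have [d Hd] : exists d, y d != 1%g.
      apply/existsP; apply: contraNT yN; rewrite negb_exists => /forallP H.
      by apply/eqP/ffunP => d; rewrite ffunE; apply/eqP; move: (H d); rewrite negbK.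
    by rewrite (bigD1 d) //= (negPf Hd) mulr0 !mul0r addr0 mul0r.
  over.
move=> H.
transitivity (\sum_(S : {set N}) (1 - 0) ^+ #|S| * es S f x).
  by apply: eq_bigr => S _; rewrite subr0 expr1n mul1r.
rewrite -H (bigD1 (1%g : G)) //= eqxx mul1r mulg1 big1 ?addr0 // => y /negPf ->.
by rewrite mul0r.
Qed.

(** Self-adjointness comes from the invariance of the kernel under inversion. *)
Lemma es_adjoint S f g :
  avg (fun x => es S f x * g x) = avg (fun x => f x * es S g x).
Proof.
congr (_ * _); rewrite /es.
under eq_bigr do rewrite mulr_suml.
under [RHS]eq_bigr do rewrite mulr_sumr.
rewrite exchange_big [RHS]exchange_big /=.
rewrite [RHS](reindex_inj (@invg_inj G)) /=; apply: eq_bigr => y _.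
rewrite [RHS](reindex_inj (mulIg y)) /=; apply: eq_bigr => x _.
by rewrite es_kernelV mulgK; ring.
Qed.

Lemma es_norm S f : avg (fun x => es S f x ^+ 2) = avg (fun x => f x * es S f x).
Proof.
under eq_avg do rewrite expr2.
rewrite es_adjoint; apply: eq_avg => x.
by rewrite es_es eqxx mul1r.
Qed.

Lemma es_parseval f :
  \sum_(S : {set N}) avg (fun x => es S f x ^+ 2) = avg (fun x => f x ^+ 2).
Proof.
under eq_bigr do rewrite es_norm.
rewrite -avg_sum; apply: eq_avg => x.
by rewrite -mulr_sumr sum_es expr2.
Qed.

(** Components on distinct sets are orthogonal, so the cross terms vanish. *)
Lemma es_norm_sum (P : pred {set N}) f :
  avg (fun x => (\sum_(S | P S) es S f x) ^+ 2) =
  \sum_(S | P S) avg (fun x => es S f x ^+ 2).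
Proof.
under eq_avg do rewrite expr2 mulr_suml.
rewrite avg_sum; apply: eq_bigr => S PS.
under eq_avg do rewrite mulr_sumr.
rewrite avg_sum (bigD1 S) //= big1 ?addr0.
  by apply: eq_avg => x; rewrite expr2.
move=> T /andP[_ /negPf ST]; rewrite es_adjoint.
by apply: avg_eq0 => x; rewrite es_es eq_sym ST mul0r mulr0.
Qed.

Lemma es_conv S f g z :
  \sum_y es S f y * g (y^-1 * z)%g = \sum_y f y * es S g (y^-1 * z)%g.
Proof.
rewrite /es.
under eq_bigr do rewrite mulr_suml.
under [RHS]eq_bigr do rewrite mulr_sumr.
rewrite exchange_big /=.
under eq_bigr => w _.
  rewrite (reindex_inj (mulIg w^-1%g)) /=; under eq_bigr do rewrite mulgKV; over.
rewrite exchange_big /=; apply: eq_bigr => y _.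
(* The arguments of [g] are now [w * v] on the left and [v * w] on the right; conjugating [w] by [v]
   matches them and leaves the central kernel unchanged. *)
pose v := (y^-1 * z)%g.
have hI : injective (fun w : G => v * w * v^-1)%g by move=> w w' /mulIg /mulgI.
rewrite (reindex_inj hI) /=; apply: eq_bigr => w _.
have -> : es_kernel S (v * w * v^-1)%g = es_kernel S w.
  by rewrite -[RHS](es_kernelJ S v^-1%g) invgK.
by rewrite [((y * _)^-1)%g]invMg invgK -[(_ * y^-1 * z)%g]mulgA -/v mulgKV mulrCA mulrA.
Qed.

(** The projection is idempotent, so one copy can be moved to the left factor while another stays on
    the right. *)
Lemma es_conv_diag S f g z :
  \sum_y f y * es S g (y^-1 * z)%g = \sum_y es S f y * es S g (y^-1 * z)%g.
Proof.
rewrite es_conv; apply: eq_bigr => y _.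
by rewrite es_es eqxx mul1r.
Qed.

(** Outside [S] the kernel factors are constant; after a translation of the sum, [x] enters only
    through its coordinates in [S]. *)
Lemma es_local S f x x' : {in S, x =1 x'} -> es S f x = es S f x'.
Proof.
move=> xx'; rewrite /es (reindex_inj (mulgI x^-1%g)) /=.
rewrite [RHS](reindex_inj (mulgI x'^-1%g)) /=; apply: eq_bigr => y _.
rewrite !mulVKg; congr (_ * _); apply: eq_bigr => d _.
by rewrite !ffunE; case: (boolP (d \in S)) => // /xx' ->.
Qed.

(** At a coordinate of [T] outside [S] the function [h] is constant, while the kernel factor there
    sums to zero. *)
Lemma es_eq0_local S T h :
  (forall x x', {in S, x =1 x'} -> h x = h x') -> ~~ (T \subset S) ->
  forall x : G, es T h x = 0.
Proof.
move=> hS /subsetPn[e eT eNS] x.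
(* Translation by [c t] moves coordinate [e] only; summing over [t] isolates the kernel factor at
   [e]. *)
pose c (t : gT) : G := [ffun d => if d == e then t else 1%g].
apply: (mulfI natr_card_group_neq0); rewrite mulr0 mulr_natl -sumr_const.
transitivity (\sum_t \sum_(y : G) es_kernel T (y * (c t)^-1)%g * h (x * y)%g).
  apply: eq_bigr => t _; rewrite [RHS](reindex_inj (mulIg (c t))) /=.
  apply: eq_bigr => y _; rewrite mulgK; congr (_ * _); apply: hS => d dS.
  rewrite !ffunE; case: eqP => [de|_]; last by rewrite mulg1.
  by rewrite de (negPf eNS) in dS.
rewrite exchange_big big1 //= => y _; rewrite -mulr_suml.
transitivity ((\sum_t es_factor true (y e * t^-1)%g
   * \prod_(d | d != e) es_factor (d \in T) (y d)) * h (x * y)%g).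
  congr (_ * _); apply: eq_bigr => t _.
  rewrite /es_kernel (bigD1 e) //= !ffunE eqxx eT; congr (_ * _).
  by apply: eq_bigr => d /negPf de; rewrite !ffunE de invg1 mulg1.
rewrite -mulr_suml.
have hI : injective (fun t : gT => y e * t^-1)%g by move=> t t' /mulgI /invg_inj.
have := es_factor_sum true; rewrite (reindex_inj hI) /= => ->.
by rewrite !mul0r.
Qed.

Lemma es_set0 f x : es set0 f x = avg f.
Proof.
rewrite /es [avg f]mulr_sumr [RHS](reindex_inj (mulgI x)) /=.
apply: eq_bigr => y _; congr (_ * _); rewrite /es_kernel.
under eq_bigr do rewrite inE /es_factor expr0 mul1r add0r.
by rewrite prodr_const card_ffun natrX exprVn.
Qed.

End EfronStein.

(** * Spectral weights of a family of functions *)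

Section Weight.
Variables (R : realType) (gT : finGroupType) (N I : finType).
Variable F : I -> {ffun N -> gT} -> R.

Definition es_weight (S : {set N}) : R :=
  \sum_i avg (fun x => es S (F i) x ^+ 2).

Lemma es_weight_ge0 S : 0 <= es_weight S.
Proof. by apply: sumr_ge0 => i _; apply: avg_ge0 => x; apply: sqr_ge0. Qed.

(** By Parseval the weights form a subprobability on sets, from which the random labels are later
    drawn. *)
Lemma es_weight_le1 :
  (forall x, \sum_i F i x ^+ 2 <= 1) -> \sum_(S : {set N}) es_weight S <= 1.
Proof.
move=> F1; rewrite exchange_big /=.
under eq_bigr do rewrite es_parseval.
rewrite -avg_sum -[leRHS](avg_cst (1%g : {ffun N -> gT})).
exact: ler_avg.
Qed.

End Weight.

(** * Correlation of the two tables across one edge *)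

Definition pullback (gT D E : finType) (p : D -> E) (a : {ffun E -> gT})
  : {ffun D -> gT} := [ffun d => a (p d)].

Section Correlation.
Variables (R : realType) (gT gT2 : finGroupType) (D E : finType) (p : D -> E).
Variables (F : gT2 -> {ffun E -> gT} -> R) (Q : gT2 -> {ffun D -> gT} -> R).
Implicit Types (S : {set D}) (x y : gT2) (a : {ffun E -> gT}).

(* The product in the group algebra of [gT2] of the [S]-components of the two
   copies of [Q], averaged over [b]; the index [x] is the inverse of the
   product of the indices of the two factors. *)
Definition autocorr S x a : R :=
  avg (fun b : {ffun D -> gT} => \sum_y
    es S (Q y) b * es S (Q (y^-1 * x^-1)%g) (b^-1 * (pullback p a)^-1)%g).

Definition correlation S : R := \sum_x avg (fun a => F x a * autocorr S x a).

Definition image_weight S : R :=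
  \sum_(T : {set E} | (T != set0) && (T \subset p @: S)) es_weight F T.

Lemma noise_correlation (eps : R) :
  avg (fun a => avg (fun b => \sum_(nu : {ffun D -> gT})
    (\prod_d noise_mass eps (nu d)) * \sum_x \sum_y F x a * (Q y b *
       Q (y^-1 * x^-1)%g (b^-1 * (pullback p a)^-1 * nu)%g))) =
  \sum_(S : {set D}) (1 - eps) ^+ #|S| * correlation S.
Proof.
under [RHS]eq_bigr do rewrite /correlation -avg_sum -avgZ.
rewrite -avg_sum; apply: eq_avg => a.
under eq_avg => b.
  under eq_bigr do rewrite mulr_sumr.
  rewrite exchange_big /=.
  under eq_bigr => x _.
    under eq_bigr do rewrite mulr_sumr.
    rewrite exchange_big /=.
    under eq_bigr => y _.
      under eq_bigr do rewrite mulrCA [X in _ * X]mulrCA.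
      rewrite -mulr_sumr -mulr_sumr noise_decomposition.
      rewrite mulr_sumr mulr_sumr.
      over.
    rewrite exchange_big /=.
    over.
  rewrite exchange_big /=.
  over.
rewrite avg_sum; apply: eq_bigr => S _.
rewrite avg_sum mulr_sumr; apply: eq_bigr => x _.
rewrite /autocorr !avg_sum !mulr_sumr; apply: eq_bigr => y _.
rewrite -!avgZ /avg.
congr (_ * _); under eq_bigr do rewrite [X in _ * X]mulrCA.
(* The sum over [b] is a convolution evaluated at the inverse of [pullback p a], so the projection
   produced by the noise can be put on both factors. *)
by rewrite -!mulr_sumr -es_conv_diag mulrCA.
Qed.

(** This is [2 * |u * v| <= u ^+ 2 + v ^+ 2]; both squares have the same total because the
    substitutions in [b] and in [y] are bijections. *)
Lemma autocorr_bound S x a : `|autocorr S x a| <= es_weight Q S.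
Proof.
have -> : es_weight Q S = avg (fun b : {ffun D -> gT} => \sum_y
    (es S (Q y) b ^+ 2 / 2 +
     es S (Q (y^-1 * x^-1)%g) (b^-1 * (pullback p a)^-1)%g ^+ 2 / 2)).
  under [RHS]eq_avg do rewrite big_split -!mulr_suml /=.
  rewrite avgD /es_weight.
  have hI : injective (fun b : {ffun D -> gT} => b^-1 * (pullback p a)^-1)%g.
    by move=> b b' /mulIg /invg_inj.
  have hJ : injective (fun y : gT2 => y^-1 * x^-1)%g.
    by move=> y y' /mulIg /invg_inj.
  rewrite (eq_avg (g := fun b => 2^-1 * \sum_y es S (Q y) b ^+ 2)); last first.
    by move=> b; rewrite mulrC.
  rewrite [X in _ + X](eq_avg (g := (fun b => 2^-1 * \sum_y es S (Q y) b ^+ 2)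
      \o (fun b : {ffun D -> gT} => b^-1 * (pullback p a)^-1)%g)); last first.
    by move=> b; rewrite mulrC /= [in RHS](reindex_inj hJ).
  rewrite -(reindex_avg _ hI) avgZ avg_sum.
  lra.
rewrite /autocorr /avg normrM ger0_norm ?invr_ge0 ?ler0n //.
rewrite ler_wpM2l ?invr_ge0 ?ler0n //.
apply: le_trans (ler_norm_sum _ _ _) _; apply: ler_sum => b _.
apply: le_trans (ler_norm_sum _ _ _) _; apply: ler_sum => y _.
set u := es _ _ _; set v := es _ _ _.
have := sqr_ge0 (u + v); have := sqr_ge0 (u - v).
by rewrite ler_norml; move=> ? ?; apply/andP; split; lra.
Qed.

Lemma autocorr_local S x a a' :
  {in p @: S, a =1 a'} -> autocorr S x a = autocorr S x a'.
Proof.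
move=> aa'; apply: eq_avg => b; apply: eq_bigr => y _; congr (_ * _).
apply: es_local => d dS; rewrite !ffunE aa' //; exact: imset_f.
Qed.

(** The crude bound, meant for large [S], where the noise supplies the small factor. *)
Lemma correlation_le S (M : R) :
  (forall a, \sum_x `|F x a| <= M) -> correlation S <= M * es_weight Q S.
Proof.
move=> FM; rewrite /correlation -avg_sum.
rewrite -[leRHS](avg_cst (1%g : {ffun E -> gT})).
apply: ler_avg => a.
apply: le_trans (ler_wpM2r (es_weight_ge0 Q S) (FM a)).
rewrite mulr_suml; apply: ler_sum => x _.
apply: le_trans (ler_norm _) _; rewrite normrM.
by rewrite ler_wpM2l // autocorr_bound.
Qed.

(** As a function of [a], [autocorr] depends only on the coordinates in [p @: S], and [F x] has mean
    zero; hence only the components of [F x] on nonempty subsets of [p @: S] contribute. *)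
Lemma correlation_le_image_weight S (delta : R) :
  0 < delta -> (forall x, avg (F x) = 0) ->
  correlation S <= es_weight Q S *
    (#|gT2|%:R / delta * image_weight S + delta / 4).
Proof.
move=> d0 F0; set q := es_weight Q S; set n := #|gT2|%:R.
have q0 : 0 <= q by apply: es_weight_ge0.
have n0 : 0 < n by rewrite ltr0n -cardsT cardG_gt0.
pose P := fun T : {set E} => (T != set0) && (T \subset p @: S).
pose G x a := \sum_(T | P T) es T (F x) a.
have FG x : avg (fun a => F x a * autocorr S x a) =
            avg (fun a => G x a * autocorr S x a).
  under eq_avg do rewrite -sum_es mulr_suml.
  under [RHS]eq_avg do rewrite mulr_suml.
  rewrite !avg_sum [RHS]big_mkcond /=; apply: eq_bigr => T _.
  case: ifPn => //; rewrite /P; have [->|_] /= := eqVneq T set0 => TS.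
    by apply: avg_eq0 => a; rewrite es_set0 F0 mul0r.
  rewrite es_adjoint; apply: avg_eq0 => a.
  by rewrite (es_eq0_local (@autocorr_local S x) TS) mulr0.
have GW : \sum_x avg (fun a => G x a ^+ 2) = image_weight S.
  rewrite /image_weight exchange_big /=; apply: eq_bigr => x _.
  exact: es_norm_sum.
(* The weighted inequality below divides by [q]; if [q] is zero, [autocorr] vanishes. *)
move: q0; rewrite le_eqVlt => /predU1P[q0|q0].
  rewrite -q0 mul0r.
  rewrite /correlation big1 // => x _; apply: avg_eq0 => a.
  have := autocorr_bound S x a; rewrite -/q -q0 normr_le0 => /eqP ->.
  by rewrite mulr0.
have step x : avg (fun a => F x a * autocorr S x a) <=
    q * n / delta * avg (fun a => G x a ^+ 2) + q * delta / (4 * n).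
  rewrite FG -[X in _ + X](avg_cst (1%g : {ffun E -> gT})) -avgZ -avgD.
  apply: ler_avg => a.
  set s := G x a; set h := autocorr S x a.
  have h2 : h ^+ 2 <= q ^+ 2.
    by rewrite -real_normK ?num_real // lerXn2r ?nnegrE ?normr_ge0 ?(ltW q0) // autocorr_bound.
  (* Completing the square, with coefficients chosen so that the [h] terms, at most
     [q * delta / (4 * n)] each, sum to [q * delta / 4] over the [n] values of [x]. *)
  have -> : s * h = q * n / delta * s ^+ 2 + delta / (4 * n * q) * h ^+ 2 -
      q * n / delta * (s - delta / (2 * n * q) * h) ^+ 2.
    by field; rewrite !gt_eqF.
  have -> : q * delta / (4 * n) = delta / (4 * n * q) * q ^+ 2.
    by field; rewrite !gt_eqF.
  have c0 : 0 <= q * n / delta by rewrite !mulr_ge0 ?invr_ge0 ?ltW.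
  have c1 : 0 <= delta / (4 * n * q).
    by rewrite divr_ge0 ?mulr_ge0 ?ltW.
  have := ler_wpM2l c1 h2.
  have := mulr_ge0 c0 (sqr_ge0 (s - delta / (2 * n * q) * h)).
  lra.
apply: le_trans (ler_sum _ (fun x _ => step x)) _.
rewrite big_split /= -mulr_sumr GW sumr_const -[_ *+ #|_|]mulr_natr -/n.
by rewrite le_eqVlt; apply/orP; left; apply/eqP; field; rewrite !gt_eqF.
Qed.

End Correlation.

(** * Indicators of a folded table, made orthogonal to constants *)

Section Folding.
Variables (R : realType) (gT : finGroupType) (H : {group gT}).

Definition coset_defect (T : Type) (A : T -> gT) (x : gT) (a : T) : R :=
  (A a == x)%:R - #|H|%:R^-1 * ((A a * x^-1)%g \in H)%:R.

Lemma natr_cardG_gt0 : 0 < #|H|%:R :> R.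
Proof. by rewrite ltr0n cardG_gt0. Qed.

Lemma sum_eq_indicator (T : finType) (t : T) : \sum_x (t == x)%:R = 1 :> R.
Proof.
rewrite (bigD1 t) //= eqxx big1 ?addr0 // => x /negPf.
by rewrite eq_sym => ->.
Qed.

Lemma sum_coset_indicator (t : gT) :
  \sum_x #|H|%:R^-1 * ((t * x^-1)%g \in H)%:R = 1 :> R.
Proof.
have hI : injective (fun x : gT => x^-1 * t)%g by move=> x y /mulIg /invg_inj.
rewrite (reindex_inj hI) /= -mulr_sumr.
under eq_bigr do rewrite invMg invgK mulKVg.
suff -> : \sum_x (x \in H)%:R = #|H|%:R :> R by rewrite mulVf // gt_eqF ?natr_cardG_gt0.
rewrite -sum1_card natr_sum [RHS]big_mkcond /=.
by apply: eq_bigr => x _; case: (x \in H).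
Qed.

(** In the variable [x], the defect is the difference of two probability distributions: a point mass
    and the uniform one on a coset. *)
Lemma coset_defect_norm1 (T : Type) (A : T -> gT) (a : T) :
  \sum_x `|coset_defect A x a| <= 2.
Proof.
have -> : 2 = \sum_x ((A a == x)%:R + #|H|%:R^-1 * ((A a * x^-1)%g \in H)%:R) :> R.
  by rewrite big_split /= sum_eq_indicator sum_coset_indicator.
apply: ler_sum => x _; apply: le_trans (ler_normB _ _) _.
by rewrite !ger0_norm ?mulr_ge0 ?invr_ge0 ?ler0n.
Qed.

Lemma coset_defect_norm2 (T : Type) (A : T -> gT) (a : T) :
  \sum_x coset_defect A x a ^+ 2 <= 1.
Proof.
have H0 := natr_cardG_gt0; set h : R := #|H|%:R^-1.
have h0 : 0 <= h by rewrite invr_ge0 ltW.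
have -> : \sum_x coset_defect A x a ^+ 2 = \sum_x ((1 - 2 * h) * (A a == x)%:R +
    h * (#|H|%:R^-1 * ((A a * x^-1)%g \in H)%:R)).
  apply: eq_bigr => x _; rewrite /coset_defect -/h.
  have [<-|_] := eqVneq (A a) x; first by rewrite mulgV group1 /=; ring.
  by case: (_ \in H) => /=; ring.
rewrite big_split /= -mulr_sumr sum_eq_indicator -mulr_sumr sum_coset_indicator.
lra.
Qed.

(** Equivariance makes the values [y * x], for [y] in [H], equally likely, so the indicator and its
    coset average have the same mean. *)
Lemma coset_defect_mean0 (T : finType) (A : T -> gT) x :
  (forall y, y \in H -> exists2 h, injective h & forall a, A (h a) = (y * A a)%g) ->
  avg (coset_defect A x) = 0.
Proof.
move=> eqA; rewrite avgD.
have -> : avg (fun a => - (#|H|%:R^-1 * ((A a * x^-1)%g \in H)%:R)) =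
    - (#|H|%:R^-1 * \sum_(y in H) avg (fun a => (A a == y * x)%g%:R)) :> R.
  under eq_avg do rewrite -mulNr.
  rewrite avgZ mulNr -avg_sum; congr (- (_ * _)); apply: eq_avg => a.
  case: (boolP (_ \in H)) => AH.
    rewrite (bigD1 _ AH) /= mulgKV eqxx big1 ?addr0 // => y /andP[_ /negPf yN].
    case: eqP => // Ay; by rewrite Ay mulgK eqxx in yN.
  rewrite big1 // => y yH; case: eqP => // Ay.
  by rewrite Ay mulgK yH in AH.
rewrite (eq_bigr (fun=> avg (fun a => (A a == x)%:R))) => [|y yH].
  by rewrite sumr_const -[avg _ *+ _]mulr_natl mulKf ?subrr // gt_eqF ?natr_cardG_gt0.
have [h hI hA] := eqA y yH; rewrite (reindex_avg _ hI); apply: eq_avg => a /=.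
by rewrite hA (inj_eq (mulgI y)).
Qed.

(** Only [y = s] and [x = (s * t)^-1] survive in the double sum, which is then the indicator minus
    either [#|H|%:R^-1] or 0. *)
Lemma eq1_le_coset_defect (T : Type) (A : T -> gT) (a : T) (s t : gT) :
  (A a * s * t == 1)%g%:R <= #|H|%:R^-1 +
    \sum_x \sum_y coset_defect A x a * ((s == y)%:R * (t == y^-1 * x^-1)%g%:R).
Proof.
have collapse x : \sum_y coset_defect A x a * ((s == y)%:R * (t == y^-1 * x^-1)%g%:R) =
    (x == (s * t)^-1)%g%:R * coset_defect A x a.
  rewrite (bigD1 s) //= eqxx mul1r big1 ?addr0 => [|y /negPf].
    rewrite mulrC; congr ((nat_of_bool _)%:R * _).
    by apply/idP/idP => /eqP ->; rewrite ?mulKVg ?invgK ?mulKg.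
  by rewrite eq_sym => ->; rewrite mul0r mulr0.
under eq_bigr do rewrite collapse.
rewrite sum_eq1 /coset_defect invgK mulgA.
have -> : (A a == (s * t)^-1)%g = (A a * s * t == 1)%g.
  by rewrite [LHS]eq_mulgV1 invgK mulgA.
have h0 : 0 <= #|H|%:R^-1 :> R by rewrite invr_ge0 ler0n.
by case: (_ \in H); rewrite ?mulr1 ?mulr0; lra.
Qed.

End Folding.

(** * Averaging a table over the sign of the exponent *)

Section Symmetrization.
Variables (R : realType) (gT gT2 : finGroupType) (N : finType).
Variable B : {ffun N -> gT} -> gT2.

Definition symmetrized (y : gT2) (b : {ffun N -> gT}) : R :=
  avg (fun s : bool => (signg s (B (signg s b)) == y)%:R).

(** In the variable [y] this is a probability distribution, whose values are at most 1. *)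
Lemma symmetrized_norm2 b : \sum_y symmetrized y b ^+ 2 <= 1.
Proof.
have -> : 1 = \sum_y symmetrized y b :> R.
  rewrite /symmetrized -avg_sum; under eq_avg do rewrite sum_eq_indicator.
  by rewrite (avg_cst true).
apply: ler_sum => y _; rewrite expr2 ler_piMr //.
  by apply: avg_ge0 => s; rewrite ler0n.
rewrite -[leRHS](avg_cst true); apply: ler_avg => s.
by case: (_ == y).
Qed.

End Symmetrization.

(** * Acceptance probability of the test on one edge *)

Lemma noise_mass_ge0 (R : realType) (gT : finGroupType) (eps : R) (x : gT) :
  0 <= eps -> eps <= 1 -> 0 <= noise_mass eps x.
Proof.
by move=> e0 e1; rewrite addr_ge0 ?mulr_ge0 ?invr_ge0 ?ler0n ?subr_ge0.
Qed.

Lemma noise_mass_sum (R : realType) (gT : finGroupType) (D : finType) (eps : R) :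
  \sum_(nu : {ffun D -> gT}) \prod_d noise_mass eps (nu d) = 1.
Proof.
rewrite -(bigA_distr_bigA (fun _ => noise_mass eps)) big1 // => d _.
have := es_factor_sum R gT false; rewrite /es_factor /= => Hf.
rewrite /noise_mass big_split /= -!mulr_sumr.
under eq_bigr do rewrite eq_sym.
rewrite sum_eq_indicator -[X in eps * X]mulr1.
have -> : \sum_(i : gT) #|gT|%:R^-1 = 1 :> R.
  by rewrite -[RHS]Hf; apply: eq_bigr => t _; rewrite expr0 mul1r add0r.
by rewrite !mulr1 subrK.
Qed.

Section EdgeTest.
Variables (R : realType) (gT gT2 : finGroupType) (H : {group gT2}).
Variables (D E : finType) (p : D -> E).
Variables (A : {ffun E -> gT} -> gT2) (B : {ffun D -> gT} -> gT2).
Variables (eps delta : R) (k : nat).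

Local Notation F := (coset_defect R H A).
Local Notation Q := (symmetrized R B).

Definition acceptance : R :=
  avg (fun a => avg (fun b : {ffun D -> gT} => \sum_(nu : {ffun D -> gT})
    (\prod_d noise_mass eps (nu d)) *
    avg (fun s1 : bool => avg (fun s2 : bool =>
      (A a * signg s1 (B (signg s1 b)) *
        signg s2 (B (signg s2 (b^-1 * (pullback p a)^-1 * nu))) == 1)%g%:R)))).

Lemma acceptance_le_correlation : 0 <= eps -> eps <= 1 ->
  acceptance <= #|H|%:R^-1 +
    \sum_(S : {set D}) (1 - eps) ^+ #|S| * correlation p F Q S.
Proof.
move=> e0 e1; rewrite -noise_correlation.
rewrite -[X in X + _](avg_cst (1%g : {ffun E -> gT})) -avgD.
apply: ler_avg => a.
rewrite -[X in X + _](avg_cst (1%g : {ffun D -> gT})) -avgD.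
apply: ler_avg => b.
rewrite -[X in X + _]mul1r -[X in X * _ + _](noise_mass_sum gT D eps).
rewrite mulr_suml -big_split /=; apply: ler_sum => nu _; rewrite -mulrDr.
rewrite ler_wpM2l //; first by apply: prodr_ge0 => d _; apply: noise_mass_ge0.
set c := (_ * nu)%g.
(* The two signs are independent, so the product of symmetrized tables is the average of the
   products of indicators. *)
have -> : \sum_x \sum_y F x a * (Q y b * Q (y^-1 * x^-1)%g c) =
    avg (fun s1 => avg (fun s2 => \sum_x \sum_y F x a *
      ((signg s1 (B (signg s1 b)) == y)%:R *
       (signg s2 (B (signg s2 c)) == y^-1 * x^-1)%g%:R))).
  under [RHS]eq_avg do rewrite avg_sum.
  rewrite avg_sum; apply: eq_bigr => x _.
  under [RHS]eq_avg do rewrite avg_sum.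
  rewrite avg_sum; apply: eq_bigr => y _.
  under [RHS]eq_avg do rewrite avgZ avgZ.
  by rewrite avgZ; congr (_ * _); under [RHS]eq_avg do rewrite mulrC; rewrite avgZ mulrC.
rewrite -[X in X + _](avg_cst true) -avgD; apply: ler_avg => s1.
rewrite -[X in X + _](avg_cst true) -avgD; apply: ler_avg => s2.
exact: eq1_le_coset_defect.
Qed.

Lemma acceptance_le : 0 <= eps -> eps <= 1 -> 0 < delta ->
  (1 - eps) ^+ k <= delta / 4 ->
  (forall y, y \in H ->
     exists2 h, injective h & forall a, A (h a) = (y * A a)%g) ->
  acceptance <= #|H|%:R^-1 + (3 * delta / 4 + #|gT2|%:R / delta *
    \sum_(S : {set D} | (#|S| < k)%N) es_weight Q S * image_weight p F S).
Proof.
move=> e0 e1 d0 epsk eqA.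
apply: le_trans (acceptance_le_correlation e0 e1) _; rewrite lerD2l.
have F0 x : avg (F x) = 0 by apply: coset_defect_mean0.
have q1 : \sum_S es_weight Q S <= 1 by apply/es_weight_le1/symmetrized_norm2.
set n := #|gT2|%:R / delta.
have n0 : 0 <= n by rewrite divr_ge0 ?ler0n ?ltW.
(* Per unit of weight, a small set costs [delta / 4] besides its image weight and a large one
   [2 * (delta / 4)]; [3 * delta / 4] covers both. *)
have bound (S : {set D}) : (1 - eps) ^+ #|S| * correlation p F Q S <=
    3 * delta / 4 * es_weight Q S +
    (if (#|S| < k)%N then n * (es_weight Q S * image_weight p F S) else 0).
  have q0 := es_weight_ge0 Q S; set q := es_weight Q S in q0 *.
  have g0 : 0 <= image_weight p F S by apply: sumr_ge0 => T _; apply: es_weight_ge0.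
  have t0 : 0 <= (1 - eps) ^+ #|S| by rewrite exprn_ge0 // subr_ge0.
  have t1 : (1 - eps) ^+ #|S| <= 1 by rewrite exprn_ile1 ?subr_ge0 // lerBlDr lerDl.
  case: ltnP => Sk.
    have := correlation_le_image_weight p Q S d0 F0; rewrite -/n -/q => Hc.
    apply: le_trans (ler_wpM2l t0 Hc) _.
    have c0 : 0 <= q * (n * image_weight p F S + delta / 4).
      by rewrite mulr_ge0 // addr_ge0 ?(mulr_ge0 n0 g0) // divr_ge0 // ltW.
    apply: le_trans (ler_piMl c0 t1) _.
    have := mulr_ge0 q0 (ltW d0).
    lra.
  have tk : (1 - eps) ^+ #|S| <= delta / 4.
    apply: le_trans epsk; rewrite ler_wiXn2l ?subr_ge0 // lerBlDr lerDl //.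
  have Hc : correlation p F Q S <= 2 * q.
    by apply: correlation_le => a; apply: coset_defect_norm1.
  apply: le_trans (ler_wpM2l t0 Hc) _; rewrite addr0.
  have c0 : 0 <= 2 * es_weight Q S by rewrite mulr_ge0.
  apply: le_trans (ler_wpM2r c0 tk) _; rewrite -/q.
  have := mulr_ge0 q0 (ltW d0).
  lra.
apply: le_trans (ler_sum _ (fun S _ => bound S)) _.
rewrite big_split /= -mulr_sumr -big_mkcond /= -mulr_sumr lerD2r.
by rewrite ler_piMr // divr_ge0 // mulr_ge0 // ltW.
Qed.

End EdgeTest.

(** * Random labels and their derandomization *)

Section Labelling.
Variable R : realType.

(* Choose a set with probability [w], then a uniform element of that set. *)
Definition label_mass (N : finType) (w : {set N} -> R) (d : N) : R :=
  \sum_(S : {set N}) (d \in S)%:R * (w S / #|S|%:R).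

Lemma label_mass_ge0 (N : finType) (w : {set N} -> R) d :
  (forall S, 0 <= w S) -> 0 <= label_mass w d.
Proof.
by move=> w0; apply: sumr_ge0 => S _; rewrite mulr_ge0 ?divr_ge0 ?ler0n.
Qed.

(** Equality can fail even for total weight 1, since the empty set offers no label and its weight is
    lost. *)
Lemma label_mass_le1 (N : finType) (w : {set N} -> R) :
  (forall S, 0 <= w S) -> \sum_S w S <= 1 -> \sum_d label_mass w d <= 1.
Proof.
move=> w0; apply: le_trans; rewrite exchange_big /=; apply: ler_sum => S _.
have -> : \sum_d (d \in S)%:R * (w S / #|S|%:R) = #|S|%:R * (w S / #|S|%:R).
  rewrite -mulr_suml; congr (_ * _).
  rewrite -[in RHS]sum1_card natr_sum [RHS]big_mkcond /=.
  by apply: eq_bigr => d _; case: (d \in S).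
have [->|S0] := eqVneq S set0; first by rewrite cards0 mul0r.
by rewrite mulrC divfK // pnatr_eq0 cards_eq0.
Qed.

(** If [T] is contained in [p @: S], at least [#|T|] elements of [S] map into [T], so uniform
    choices from [S] and [T] match with probability at least [1 / #|S|], hence at least [1 / k]. *)
Lemma label_mass_match (D E : finType) (p : D -> E) (k : nat)
    (q : {set D} -> R) (r : {set E} -> R) :
  (forall S, 0 <= q S) -> (forall T, 0 <= r T) ->
  \sum_(S : {set D} | (#|S| < k)%N)
    q S * \sum_(T : {set E} | (T != set0) && (T \subset p @: S)) r T <=
  k%:R * \sum_d label_mass q d * label_mass r (p d).
Proof.
move=> q0 r0.
have -> : \sum_d label_mass q d * label_mass r (p d) =
    \sum_(S : {set D}) \sum_(T : {set E}) \sum_d (d \in S)%:R * (p d \in T)%:R *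
      (q S / #|S|%:R * (r T / #|T|%:R)).
  rewrite [RHS](eq_bigr _ (fun S _ => exchange_big _ _ _ _ _ _)) /= exchange_big /=.
  apply: eq_bigr => d _; rewrite /label_mass mulr_suml; apply: eq_bigr => S _.
  by rewrite mulr_sumr; apply: eq_bigr => T _; ring.
rewrite mulr_sumr big_mkcond /=; apply: ler_sum => S _.
have nn (T : {set E}) : 0 <= \sum_d (d \in S)%:R * (p d \in T)%:R *
      (q S / #|S|%:R * (r T / #|T|%:R)).
  by apply: sumr_ge0 => d _; rewrite !mulr_ge0 ?invr_ge0 ?ler0n.
case: ltnP => Sk; last by rewrite mulr_ge0 ?ler0n // sumr_ge0.
rewrite !mulr_sumr big_mkcond /=; apply: ler_sum => T _.
case: ifP => [/andP[T0 TS]|_]; last by rewrite mulr_ge0 ?ler0n.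
have Tgt : 0 < #|T|%:R :> R by rewrite ltr0n card_gt0.
have Sgt : 0 < #|S|%:R :> R.
  rewrite ltr0n; apply: leq_trans (leq_imset_card p S).
  by apply: leq_trans (subset_leq_card TS); rewrite card_gt0.
rewrite -mulr_suml.
have cardle : #|T|%:R <= \sum_d (d \in S)%:R * (p d \in T)%:R :> R.
  have -> : \sum_d (d \in S)%:R * (p d \in T)%:R =
      #|[set d in S | p d \in T]|%:R :> R.
    rewrite -[in RHS]sum1_card natr_sum [RHS]big_mkcond /=.
    apply: eq_bigr => d _; rewrite inE.
    by case: (d \in S); case: (p d \in T); rewrite /= ?mulr1 ?mulr0 ?mul0r.
  rewrite ler_nat; apply: leq_trans (leq_imset_card p _).
  apply/subset_leq_card/subsetP => e eT.
  have /imsetP[d dS ed] := subsetP TS e eT.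
  by apply/imsetP; exists d; rewrite // inE dS -ed.
have c0 : 0 <= q S / #|S|%:R * (r T / #|T|%:R).
  by rewrite !mulr_ge0 ?invr_ge0 ?ler0n.
apply: le_trans (ler_wpM2l (ler0n _ k) (ler_wpM2r c0 cardle)).
have -> : k%:R * (#|T|%:R * (q S / #|S|%:R * (r T / #|T|%:R))) =
    (k%:R / #|S|%:R) * (q S * r T).
  by field; rewrite !gt_eqF.
by rewrite ler_peMl ?mulr_ge0 // ler_pdivlMr // mul1r ler_nat ltnW.
Qed.

Lemma exists_ge_mean (T : finType) (w c : T -> R) (t0 : T) :
  (forall t, 0 <= w t) -> \sum_t w t <= 1 -> (forall t, 0 <= c t) ->
  exists t, \sum_s w s * c s <= c t.
Proof.
move=> w0 w1 c0; case: (@arg_maxP _ R T t0 xpredT c erefl) => t _ tmax.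
exists t; apply: le_trans (ler_piMl (c0 t) w1).
by rewrite mulr_suml; apply: ler_sum => s _; rewrite ler_wpM2l //; apply: tmax.
Qed.

Variables (U V D E : finType) (S : label_cover U V D E).

(** Conditional expectations: [hD] is fixed first, against random labels on [V], and then [hE] is
    chosen against [hD]. *)
Lemma exists_labelling (d0 : D) (e0 : E) (P : U -> D -> R) (Q : V -> E -> R) :
  (forall u d, 0 <= P u d) -> (forall u, \sum_d P u d <= 1) ->
  (forall v e, 0 <= Q v e) -> (forall v, \sum_e Q v e <= 1) ->
  exists hD hE, \sum_(e in lc_edges S) \sum_d P e.1 d * Q e.2 (lc_map S e.1 e.2 d)
    <= #|lc_satisfied S hD hE|%:R.
Proof.
move=> P0 P1 Q0 Q1.
pose c u d := \sum_(v | (u, v) \in lc_edges S) Q v (lc_map S u v d).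
have c0 u d : 0 <= c u d by apply: sumr_ge0.
have [hD hDP] := fin_all_exists
  (fun u => exists_ge_mean d0 (P0 u) (P1 u) (c0 u)).
pose c' v e : R := \sum_(u | (u, v) \in lc_edges S)
  (lc_map S u v (hD u) == e)%:R.
have c'0 v e : 0 <= c' v e by apply: sumr_ge0 => u _; rewrite ler0n.
have [hE hEP] := fin_all_exists
  (fun v => exists_ge_mean e0 (Q0 v) (Q1 v) (c'0 v)).
have split_edges (F : U -> V -> R) : \sum_(e in lc_edges S) F e.1 e.2 =
    \sum_u \sum_(v | (u, v) \in lc_edges S) F u v.
  by rewrite pair_big_dep /=; apply: eq_bigl => -[u v].
exists hD, hE.
rewrite (split_edges (fun u v => \sum_d P u d * Q v (lc_map S u v d))).
apply: (@le_trans _ _ (\sum_u c u (hD u))).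
  apply: ler_sum => u _; apply: le_trans (hDP u).
  by rewrite exchange_big /=; apply: ler_sum => d _; rewrite mulr_sumr.
have -> : #|lc_satisfied S hD hE|%:R = \sum_v c' v (hE v) :> R.
  rewrite -sum1_card natr_sum (exchange_big_dep xpredT) //=.
  rewrite -(split_edges (fun u v => (lc_map S u v (hD u) == hE v)%:R)).
  rewrite big_mkcond [RHS]big_mkcond /=; apply: eq_bigr => e _.
  by rewrite inE; case: (_ \in _); case: (_ == _).
rewrite (exchange_big_dep xpredT) //=; apply: ler_sum => v _.
apply: le_trans (hEP v).
rewrite (eq_bigr _ (fun e _ => mulr_sumr _ _ _ _)) exchange_big /=.
apply: ler_sum => u _; rewrite (bigD1 (lc_map S u v (hD u))) //= eqxx mulr1.
by rewrite lerDl sumr_ge0 // => e _; rewrite mulr_ge0 ?ler0n.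
Qed.

End Labelling.

(** * The size threshold [kappa] *)

Lemma kappa_spec (R : realType) (eps delta : R) :
  0 < eps -> eps < 1 -> 0 < delta -> delta < 1 ->
  exists k : nat, [/\ kappa eps delta = k%:Z, (0 < k)%N &
                     (1 - eps) ^+ k <= delta / 4].
Proof.
move=> e0 e1 d0 d1.
have ln2 : 0 < ln (2 : R) by rewrite ln_gt0 // ltr1n.
have lne : ln (1 - eps) < 0 by rewrite ln_lt0 // subr_gt0 e1 ltrBlDr ltrDl.
have lnd : ln delta < 0 by rewrite ln_lt0 // d0.
set r := (log2 delta - 2) / log2 (1 - eps).
have rE : r = (ln delta - 2 * ln 2) / ln (1 - eps).
  by rewrite /r /log2; field; rewrite (gt_eqF ln2) (lt_eqF lne).
have r0 : 0 < r.
  (* Numerator and denominator are both negative. *)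
  rewrite rE -mulrNN -invrN divr_gt0 ?oppr_gt0 //; lra.
have rk : r <= (kappa eps delta)%:~R by exact: ceil_ge.
have k0 : 0 < kappa eps delta by rewrite -(ltr0z R); apply: lt_le_trans rk.
exists `|kappa eps delta|%N.
have kE : kappa eps delta = `|kappa eps delta|%N by rewrite gez0_abs // ltW.
split=> //; first by rewrite absz_gt0 gt_eqF.
have xk : 0 < (1 - eps) ^+ `|kappa eps delta|%N by rewrite exprn_gt0 // subr_gt0.
rewrite -ler_ln ?posrE ?divr_gt0 // lnXn ?subr_gt0 // ln_div ?posrE //.
have -> : 4 = 2 ^+ 2 :> R by rewrite -natrX.
rewrite lnXn // -[ln 2 *+ 2]mulr_natl -[ln (1 - eps) *+ _]mulr_natr.
have -> : `|kappa eps delta|%N%:R = (kappa eps delta)%:~R :> R by rewrite [in RHS]kE.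
(* Multiplying by the negative [ln (1 - eps)] reverses the inequality and bounds the logarithm of
   the power. *)
have := ler_wnM2l (ltW lne) rk.
by rewrite rE [X in _ <= X]mulrC divfK // lt_eqF.
Qed.

(** * From the weighted system to the edge tests *)

Section SystemValue.
Variables (R : realType) (gT1 gT2 : finGroupType) (H1 : {group gT1}).
Variables (phi : {morphism H1 >-> gT2}) (U V D E : finType).
Variables (S : label_cover U V D E) (f : sys_var gT1 U V D E -> gT2).
Variables (dag : {ffun E -> gT1} -> {ffun E -> gT1}) (g : {ffun E -> gT1} -> gT1).

(** Dividing by [phi (g a)] turns each equation into one with right-hand side 1. *)
Definition folded_table (v : V) (a : {ffun E -> gT1}) : gT2 :=
  ((phi (g a))^-1 * f (inr (v, dag a)))%g.

Lemma system_value (eps : R) :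
  \sum_(q <- sys_of S eps dag g | eqn_satisfied phi f q.2) q.1 =
  #|lc_edges S|%:R^-1 * \sum_(e in lc_edges S)
     acceptance (lc_map S e.1 e.2) (folded_table e.2) (fun b => f (inl (e.1, b))) eps.
Proof.
transitivity (\sum_(e in lc_edges S) \sum_(a : {ffun E -> gT1})
    \sum_(b : {ffun D -> gT1}) \sum_(nu : {ffun D -> gT1})
    \sum_(s1 : bool) \sum_(s2 : bool)
      sys_weight S eps nu *
      (eqn_satisfied phi f (sys_eqn S dag g e a b nu s1 s2))%:R).
  rewrite big_image_cond /=.
  under [RHS]eq_bigr do rewrite !pair_bigA /=.
  rewrite pair_big_dep /= big_mkcondr /= [LHS]big_mkcond [RHS]big_mkcond /=.
  apply: eq_bigr => -[e [[[[a b] nu] s1] s2]] _ /=.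
  rewrite !inE /= andbT; case: (e \in _) => //.
  by case: eqn_satisfied; rewrite ?mulr1 ?mulr0.
rewrite mulr_sumr; apply: eq_bigr => -[u v] _ /=.
rewrite /acceptance /avg !mulr_sumr; apply: eq_bigr => a _.
rewrite !mulr_sumr; apply: eq_bigr => b _.
rewrite !mulr_sumr; apply: eq_bigr => nu _.
rewrite !mulr_sumr; apply: eq_bigr => s1 _.
rewrite !mulr_sumr; apply: eq_bigr => s2 _.
rewrite /sys_weight card_bool /eqn_satisfied /= !big_cons big_nil /= mulg1.
rewrite [in LHS]eq_sym eq_mulVg1 /folded_table !mulgA /pullback.
by ring.
Qed.

Hypothesis E_gt0 : (0 < #|E|)%N.
Hypotheses (dagP : coset_representatives H1 dag) (gP : coset_multipliers H1 dag g).

(** The representative is constant on a coset, which forces [g (h a) = g a * h^-1]; the inverse in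
    the table then brings [phi h] to the front. *)
Lemma folded_table_equivariant v y : y \in (phi @* H1)%g ->
  exists2 h, injective h & forall a, folded_table v (h a) = (y * folded_table v a)%g.
Proof.
case/morphimP => h _ hH ->.
exists (fun a => diag E h * a)%g; first exact: mulgI.
move=> a.
have dagE : dag (diag E h * a)%g = dag a.
  apply: (dagP.2); apply/setP => x; apply/imsetP/imsetP => -[k kH ->].
    exists (k * h)%g; first by rewrite groupM.
    by apply/ffunP => e; rewrite !ffunE mulgA.
  exists (k * h^-1)%g; first by rewrite groupM ?groupV.
  by apply/ffunP => e; rewrite !ffunE mulgA mulgKV.
have [[gH ga] [gH' ga']] := (gP a, gP (diag E h * a)%g).
have gE : g (diag E h * a)%g = (g a * h^-1)%g.
  (* Constant families determine their value only through a coordinate, so an element of [E] is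
     required here. *)
  have /card_gt0P[e _] := E_gt0; move: dagE.
  rewrite ga ga' => /ffunP/(_ e); rewrite !ffunE mulgA => /mulIg <-.
  by rewrite mulgK.
by rewrite /folded_table dagE gE morphM ?groupV // morphV // invMg invgK mulgA.
Qed.

End SystemValue.

(** * Averaging over the edges and choosing the labelling *)

Theorem mainTheorem5 (R : realType) (gT1 gT2 : finGroupType)
    (H1 : {group gT1}) (H2 : {group gT2}) (phi : {morphism H1 >-> gT2})
    (phi_im : (phi @* H1)%g = H2 :> {set gT2})
    (phi_ext : exists psi : {morphism [set: gT1] >-> gT2}, {in H1, psi =1 phi})
    (eps delta : R) (eps_gt0 : 0 < eps) (delta_gt0 : 0 < delta)
    (eps_delta : 1 / #|H2|%:R + delta <= 1 - eps)
    (U V D E : finType) (E_gt0 : (0 < #|E|)%N) (S : label_cover U V D E)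
    (dag : {ffun E -> gT1} -> {ffun E -> gT1}) (g : {ffun E -> gT1} -> gT1)
    (dagP : coset_representatives H1 dag)
    (gP : coset_multipliers H1 dag g) :
  system_satisfiable phi (sys_of S eps dag g) (1 / #|H2|%:R + delta) ->
  lc_satisfiable S
    (delta ^+ 2 / (4 * (kappa eps delta)%:~R * #|gT1|%:R ^ kappa eps delta
                   * #|gT2|%:R ^+ 4)).
Proof.
case=> f; rewrite system_value div1r => Hf.
have H2gt0 : 0 < #|H2|%:R^-1 :> R by rewrite invr_gt0 natr_cardG_gt0.
rewrite div1r in eps_delta.
have [||||k [-> k_gt0 epsk]] := @kappa_spec R eps delta; [lra..|].
set F := fun v => coset_defect R H2 (folded_table phi f dag g v).
set Q := fun u => symmetrized R (fun b : {ffun D -> gT1} => f (inl (u, b))).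
pose P u := label_mass (es_weight (Q u)); pose P' v := label_mass (es_weight (F v)).
set n : R := #|gT2|%:R; set ed := lc_edges S.
have n1 : 1 <= n by rewrite ler1n -cardsT cardG_gt0.
(* Without edges the value of the system would be 0, as [0^-1 = 0], below the positive threshold. *)
have ed_gt0 : 0 < #|ed|%:R :> R.
  rewrite ltr0n lt0n; apply/eqP => ed0.
  by move: Hf; rewrite -/ed ed0 invr0 mul0r; lra.
pose M e : R := \sum_d P e.1 d * P' e.2 (lc_map S e.1 e.2 d).
(* Of the advantage [delta], the edge bound absorbs [3 * delta / 4]; the remaining quarter is paid
   by matching labels. *)
have mean : #|ed|%:R * (delta / 4) <= n / delta * k%:R * \sum_(e in ed) M e.
  have : #|ed|%:R * (#|H2|%:R^-1 + delta) <= \sum_(e in ed)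
      (#|H2|%:R^-1 + (3 * delta / 4 + n / delta * (k%:R * M e))).
    rewrite -ler_pdivlMl //; apply: le_trans Hf _.
    rewrite ler_wpM2l ?invr_ge0 ?ler0n //; apply: ler_sum => e _.
    have eps_le1 : eps <= 1 by lra.
    have equiv y : y \in H2 -> exists2 h, injective h &
        forall a, folded_table phi f dag g e.2 (h a) = (y * folded_table phi f dag g e.2 a)%g.
      by rewrite -phi_im; apply: folded_table_equivariant.
    apply: le_trans (acceptance_le _ _ (ltW eps_gt0) eps_le1 delta_gt0 epsk equiv) _.
    have nd0 : 0 <= n / delta by rewrite divr_ge0 ?ler0n // ltW.
    rewrite !lerD2l; apply: (ler_wpM2l nd0).
    by apply: label_mass_match => ?; apply: es_weight_ge0.
  rewrite !big_split /= !sumr_const -!mulr_sumr.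
  rewrite -[_ *+ #|_|]mulr_natl -[_ / 4 *+ #|_|]mulr_natl.
  rewrite mulrDr lerD2l.
  lra.
(* An empty [D] would make every [M e] zero, against [mean]. *)
have [d0 _|D0] := pickP D; last first.
  move: mean; rewrite big1 => [|e _]; last by apply: big1 => d; have := D0 d.
  by rewrite mulr0 leNgt mulr_gt0 // divr_gt0.
have /card_gt0P[e0 _] := E_gt0.
have [||||hD [hE hP]] := @exists_labelling R U V D E S d0 e0 P P'.
- by move=> u d; apply: label_mass_ge0 => ?; apply: es_weight_ge0.
- move=> u; apply: label_mass_le1 => [?|]; first exact: es_weight_ge0.
  by apply: es_weight_le1 => x; apply: symmetrized_norm2.
- by move=> v e; apply: label_mass_ge0 => ?; apply: es_weight_ge0.
- move=> v; apply: label_mass_le1 => [?|]; first exact: es_weight_ge0.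
  by apply: es_weight_le1 => x; apply: coset_defect_norm2.
exists hD, hE; apply: le_trans hP; rewrite -/ed -/(M _).
set s := \sum_(e in ed) _ in mean *.
rewrite -[k%:Z%:~R]/(k%:R : R) -exprnP.
set m : R := #|gT1|%:R ^+ k.
have m1 : 1 <= m by rewrite exprn_ege1 // ler1n -cardsT cardG_gt0.
have k1 : 1 <= k%:R :> R by rewrite ler1n.
have kn0 : 0 < 4 * k%:R * n by rewrite !mulr_gt0 //; lra.
(* The denominator obtained is [4 * k * n]; it is at most the stated one because [1 <= m] and
   [n <= n ^+ 4]. *)
apply: (@le_trans _ _ (delta ^+ 2 / (4 * k%:R * n) * #|ed|%:R)).
  rewrite ler_wpM2r ?ler0n // ler_wpM2l ?sqr_ge0 // lef_pV2 ?posrE //.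
    rewrite -[leRHS]mulrA ler_wpM2l ?mulr_ge0 ?ler0n //.
    apply: le_trans (ler_eXnr (n := 4) _ n1) _ => //.
    by rewrite ler_peMl // exprn_ge0 // ler0n.
  have m0 : 0 < m by lra.
  have n0 : 0 < n by lra.
  by rewrite (mulr_gt0 _ (exprn_gt0 _ n0)) // (mulr_gt0 _ m0) // mulr_gt0 // ltr0n.
rewrite mulrAC ler_pdivrMr //.
have := ler_wpM2l (ltW delta_gt0) mean.
have -> : delta * (n / delta * k%:R * s) = n * k%:R * s.
  by field; rewrite gt_eqF.
lra.
Qed.
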